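(* Let $L:J^2\to\mathbf{R}$ be a Lagrangian and let $\Theta$ be its Cartan form on $J^3$. Let $\gamma$ be a section of the source map $J^3\to[t_0,t_1]$ projecting to a section $\sigma$ of $[t_0,t_1]\times\mathbf{R}^n\to[t_0,t_1]$, and let $j^3\sigma$ be the third jet extension of $\sigma$. (1) If $\gamma=j^3\sigma$, then $\sigma$ satisfies the Euler-Lagrange equations $\frac{\partial L}{\partial x}-\frac{d}{dt}\frac{\partial L}{\partial\dot x}+\frac{d^2}{dt^2}\frac{\partial L}{\partial\ddot x}=0$ if and only if the tangent bundle of the range of $\gamma$ is contained in the kernel of $d\Theta$. (2) If the Lagrangian $L$ is regular and the tangent bundle of the range of $\gamma$ is contained in the kernel of $d\Theta$, then $\gamma=j^3\sigma$ and $\sigma$ satisfies the Euler-Lagrange equations.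
   Context: $J^k$ is the $k$-th jet bundle of sections of $[t_0,t_1]\times\mathbf{R}^n\to[t_0,t_1]$, with coordinates $(t,x)$, $(t,x,\dot x)$, $(t,x,\dot x,\ddot x)$, $(t,x,\dot x,\ddot x,\dddot x)$ for $k=0,1,2,3$, where $x,\dot x,\ddot x,\dddot x\in\mathbf{R}^n$. The source map sends a jet to $t$. For a section $\sigma:t\mapsto(t,x(t))$, $j^k\sigma$ is its $k$-jet extension $t\mapsto(t,x(t),\dot x(t),\dots)$. All objects are smooth and $\frac{d}{dt}$ denotes the total derivative. Products such as $p_x\,dx$ mean sums over the $n$ components. The Ostrogradski momenta are the maps $J^3\to\mathbf{R}^n$ given by $p_{\dot x}=\frac{\partial L}{\partial\ddot x}$ and $p_x=\frac{\partial L}{\partial\dot x}-\frac{d}{dt}\frac{\partial L}{\partial\ddot x}$. The Cartan form is the one-form on $J^3$ $$\Theta=L\,dt+p_x(dx-\dot x\,dt)+p_{\dot x}(d\dot x-\ddot x\,dt).$$ $L$ is regular if the matrix $\left(\frac{\partial^2L}{\partial\ddot x_j\partial\ddot x_i}\right)$ is non-singular. The kernel of $d\Theta$ consists of the tangent vectors $v$ whose contraction with $d\Theta$ is zero. *)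

(* Defs.v *)
From mathcomp Require Import all_boot all_order all_algebra.
From mathcomp Require Import all_classical all_reals all_analysis.

Set Implicit Arguments.
Unset Strict Implicit.
Unset Printing Implicit Defensive.

Import Order.TTheory GRing.Theory Num.Theory.
Import numFieldNormedType.Exports.

Local Open Scope classical_set_scope.
Local Open Scope ring_scope.

(* Calculus relative to a set A on which f lives. The quotient only sees the
   points p + h v lying in A, so the derivative is one-sided where A has a
   boundary, and the values of f outside A are irrelevant. *)

Definition quotient_within (R : realType) (V W : normedModType R)
    (A : set V) (f : V -> W) (p v : V) : set_system W :=
  (fun h : R => h^-1 *: (f (h *: v + p) - f p))
    @ within [set h | A (h *: v + p)] 0^'.

Definition derivable_within (R : realType) (V W : normedModType R)
    (A : set V) (f : V -> W) (p v : V) : Prop :=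
  cvg (quotient_within A f p v).

Definition derive_within (R : realType) (V W : normedModType R)
    (A : set V) (v : V) (f : V -> W) (p : V) : W :=
  lim (quotient_within A f p v).

(* C^oo up to the boundary: all iterated directional derivatives exist and are
   continuous on A. *)
Definition smooth_on (R : realType) (V W : normedModType R)
    (A : set V) (f : V -> W) : Prop :=
  forall vs : seq V,
    let g := foldr (derive_within A) f vs in
    {within A, continuous g} /\
    forall p v, A p -> derivable_within A g p v.

(* Exterior derivative of a one-form om, written z |-> (v |-> om z v), by
   d om (u, v) = u (om v) - v (om u) for constant vector fields u and v. *)
Definition ext_derive (R : realType) (V : normedModType R)
    (A : set V) (om : V -> V -> R) (z u v : V) : R :=
  derive_within A u (om ^~ v) z - derive_within A v (om ^~ u) z.

Definition kernel2 (R : realType) (V : normedModType R)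
    (A : set V) (om2 : V -> V -> V -> R) : set (V * V) :=
  [set zv | A zv.1 /\ forall w, om2 zv.1 zv.2 w = 0].

(* A jet (t, u) has t as first component, and row i of u is the i-th
   derivative of x. The type carries all t in R; J^k itself, with t in
   [t0, t1], is the set [jets]. A tangent vector to J^k is an element of the
   same type. *)
Definition jet (R : realType) (n k : nat) : normedModType R :=
  (R * 'M[R]_(k.+1, n))%type.

Definition jets (R : realType) (n k : nat) (t0 t1 : R) : set (jet R n k) :=
  [set z | z.1 \in `[t0, t1]].
Arguments jets {R} n k t0 t1.

Definition jproj (R : realType) (n k : nat) (z : jet R n k.+1) : jet R n k :=
  (z.1, row' ord_max z.2).

Definition smooth_section (R : realType) (n k : nat) (t0 t1 : R)
    (g : R -> jet R n k) : Prop :=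
  (forall t : R, t \in `[t0, t1] -> (g t).1 = t) /\ smooth_on `[t0, t1] g.

Definition jext (R : realType) (n : nat) (t0 t1 : R) (k : nat)
    (s : R -> jet R n 0) (t : R) : jet R n k :=
  (t, \matrix_(i < k.+1, j < n)
        iter i (derive_within `[t0, t1] (1 : R)) (fun r => (s r).2 ord0 j) t).

(* Since g is a section, it is an embedding, and the tangent line to its range
   at g t is spanned by g' t. *)
Definition tangent_range (R : realType) (n k : nat) (t0 t1 : R)
    (g : R -> jet R n k) : set (jet R n k * jet R n k) :=
  [set zv | exists t c : R, t \in `[t0, t1] /\
     zv = (g t, c *: derive_within `[t0, t1] (1 : R) g t)].

(* Partial derivative with respect to the j-th component of the i-th
   derivative of x; only meaningful for i <= k. *)
Definition pd (R : realType) (n k : nat) (t0 t1 : R) (i : nat) (j : 'I_n)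
    (f : jet R n k -> R) : jet R n k -> R :=
  derive_within (jets n k t0 t1) ((0, delta_mx (inord i) j) : jet R n k) f.

(* df/dt = f_t + xdot f_x + xddot f_xdot + ... : the derivative of f along the
   vector (1, xdot, xddot, ...), whose fibre part is z.2 without its row 0. *)
Definition total_derive (R : realType) (n k : nat) (t0 t1 : R)
    (f : jet R n k -> R) (z : jet R n k.+1) : R :=
  derive_within (jets n k t0 t1) ((1, row' ord0 z.2) : jet R n k) f (jproj z).

Definition momentum_xdot (R : realType) (n : nat) (t0 t1 : R)
    (L : jet R n 2 -> R) (j : 'I_n) (z : jet R n 3) : R :=
  pd t0 t1 2 j L (jproj z).

Definition momentum_x (R : realType) (n : nat) (t0 t1 : R)
    (L : jet R n 2 -> R) (j : 'I_n) (z : jet R n 3) : R :=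
  pd t0 t1 1 j L (jproj z) - total_derive t0 t1 (pd t0 t1 2 j L) z.

Definition cartan_form (R : realType) (n : nat) (t0 t1 : R)
    (L : jet R n 2 -> R) (z v : jet R n 3) : R :=
  L (jproj z) * v.1
  + \sum_(j < n) momentum_x t0 t1 L j z
      * (v.2 (inord 0) j - z.2 (inord 1) j * v.1)
  + \sum_(j < n) momentum_xdot t0 t1 L j z
      * (v.2 (inord 1) j - z.2 (inord 2) j * v.1).

Definition euler_lagrange_expr (R : realType) (n : nat) (t0 t1 : R)
    (L : jet R n 2 -> R) (j : 'I_n) (z : jet R n 4) : R :=
  pd t0 t1 0 j L (jproj (jproj z))
  - total_derive t0 t1 (pd t0 t1 1 j L) (jproj z)
  + total_derive t0 t1 (total_derive t0 t1 (pd t0 t1 2 j L)) z.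

Definition euler_lagrange (R : realType) (n : nat) (t0 t1 : R)
    (L : jet R n 2 -> R) (s : R -> jet R n 0) : Prop :=
  forall t : R, t \in `[t0, t1] ->
    forall j : 'I_n, euler_lagrange_expr t0 t1 L j (jext t0 t1 4 s t) = 0.

Definition regular (R : realType) (n : nat) (t0 t1 : R)
    (L : jet R n 2 -> R) : Prop :=
  forall z, jets n 2 t0 t1 z ->
    \matrix_(i < n, j < n) pd t0 t1 2 j (pd t0 t1 2 i L) z \in unitmx.

(* Main.v *)
Require Import Defs.
From mathcomp Require Import all_boot all_order all_algebra.
From mathcomp Require Import all_classical all_reals all_analysis.
From mathcomp Require Import ring lra.
Set Implicit Arguments.
Unset Strict Implicit.
Unset Printing Implicit Defensive.
Import Order.TTheory GRing.Theory Num.Theory.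
Import numFieldNormedType.Exports.
Local Open Scope classical_set_scope.
Local Open Scope ring_scope.

(** Write [u] for the velocity of [gamma] at time [t], [z = gamma t], and
    [kappa_ij = u_ij - z_(i+1)j] for the value on [u] of the contact form
    [d x^(i) - x^(i+1) dt] (the time component of [u] is 1). The proof contracts
    [dTheta] with [u] and with a vertical vector [w], i.e. one with no time
    component. Nothing is lost by taking [w] vertical, since [dTheta] is bilinear
    and alternating and every tangent vector is a multiple of [u] plus a vertical
    one. The momenta are chosen so that the components of [w] along [xddot]
    cancel, and what remains is
      [dTheta(u, w) = sum_j (D_u p_x - L_x)_j w_0j + (D_u p_xdot - d/dt L_xddot)_j w_1j
                     - (D_w p_x)_j kappa_0j - (D_w p_xdot)_j kappa_1j]
    ([ext_derive_cartan_vertical]).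

    On a prolonged curve all [kappa] vanish, and then so does the second term,
    because [D_u p_xdot - d/dt L_xddot] is a combination of the [kappa]
    ([momentum_xdot_total]). The first term is minus the Euler-Lagrange
    expression, which gives the equivalence ([euler_lagrange_kernelP]).

    Conversely, if the contraction vanishes for every [w], choose [w] among the
    coordinate directions. Since [p_x] depends on [xdddot] only through
    [- d/dt L_xddot], the direction [xdddot] yields [kappa_0 Hess = 0] for the
    Hessian of [L] in [xddot]; then [xddot] yields [kappa_1 Hess = 0] and
    [xdot] yields [Hess kappa_2 = 0]. Regularity kills all three
    ([regular_contact]), which says that each row of [gamma] is the derivative
    of the previous one ([jext_of_contact]), and the equivalence applies.

    All this is pointwise algebra once directional derivatives relative to the
    slab [t0 <= t <= t1] are linear in the direction and obey the product rule.
    Linearity for functions with continuous directional derivatives comes from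
    the mean value theorem on segments inside the slab ([C1_has_diff]). *)

(** * Directional derivatives relative to a set *)

Lemma near_admissible (R : realType) (V : normedModType R) (A : set V)
    (p v : V) (P : set R) :
  (\forall h \near 0^', A (h *: v + p) -> P h) ->
  \forall h \near within [set h : R | A (h *: v + p)] 0^', P h.
Proof. by []. Qed.

Lemma admissible_filter (R : realType) (V : normedModType R) (A : set V)
    (p v : V) : Filter (within [set h : R | A (h *: v + p)] 0^').
Proof. exact: within_filter. Qed.

Lemma near_admissible_neq0 (R : realType) (V : normedModType R) (A : set V)
    (p v : V) :
  \forall h \near within [set h : R | A (h *: v + p)] 0^', h != 0.
Proof.
by apply: near_admissible; near=> h => _; near: h; exact: nbhs_dnbhs_neq.
Unshelve. all: by end_near. Qed.

Lemma admissible_to0 (R : realType) (V : normedModType R) (A : set V)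
    (p v : V) :
  (h : R) @[h --> within [set h : R | A (h *: v + p)] 0^'] --> (0 : R).
Proof.
apply/cvgrPdist_lt => e e0; apply: near_admissible.
by near=> h => _; rewrite sub0r normrN; near: h; exact: dnbhs0_lt.
Unshelve. all: by end_near. Qed.

Lemma eq_quotient_within (R : realType) (V W : normedModType R) (A : set V)
    (f g : V -> W) (p v : V) :
  (forall q, A q -> f q = g q) -> A p ->
  quotient_within A f p v = quotient_within A g p v.
Proof.
move=> fg Ap; rewrite /quotient_within eqEsubset; split; apply: near_eq_cvg;
  by apply: near_admissible; near=> h => Ah /=; rewrite !fg.
Unshelve. all: by end_near. Qed.

Lemma eq_derive_within (R : realType) (V W : normedModType R) (A : set V)
    (f g : V -> W) (p v : V) :
  (forall q, A q -> f q = g q) -> A p ->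
  derive_within A v f p = derive_within A v g p.
Proof. by move=> fg Ap; rewrite /derive_within (eq_quotient_within _ fg Ap). Qed.

Lemma derive_within_cvg (R : realType) (V W : normedModType R) (A : set V)
    (f : V -> W) (p v : V) : derivable_within A f p v ->
  quotient_within A f p v --> derive_within A v f p.
Proof. by []. Qed.

(** Linearity as a plain predicate, so that derivatives, which are not linear
    by construction, can be fed to it as mere functions. *)
Definition lform (R : realType) (V : normedModType R) (l : V -> R) : Prop :=
  forall (a : R) u v, l (a *: u + v) = a * l u + l v.

Section LinearForms.
Context (R : realType) (V : normedModType R).
Implicit Types (l : V -> R).

Lemma lform0 l : lform l -> l 0 = 0.
Proof. by move=> hl; have := hl (-1) 0 0; rewrite scaler0 addr0; lra. Qed.

Lemma lformZ l a u : lform l -> l (a *: u) = a * l u.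
Proof. by move=> hl; rewrite -[a *: u]addr0 hl (lform0 hl) addr0. Qed.

Lemma lformD l u v : lform l -> l (u + v) = l u + l v.
Proof. by move=> hl; rewrite -{1}[u]scale1r hl mul1r. Qed.

Lemma lformB l u v : lform l -> l (u - v) = l u - l v.
Proof. by move=> hl; rewrite -(scaleN1r v) (lformD u _ hl) (lformZ _ _ hl) mulN1r. Qed.

Lemma lform_sum l (I : Type) (r : seq I) (F : I -> V) :
  lform l -> l (\sum_(i <- r) F i) = \sum_(i <- r) l (F i).
Proof.
move=> hl; elim: r => [|i r IH]; first by rewrite !big_nil lform0.
by rewrite !big_cons lformD // IH.
Qed.

End LinearForms.

(** A Gateaux differential with linear dependence on the direction. Requiring
    the differential as an explicit argument lets the calculus rules compute it
    compositionally, before uniqueness identifies it with [derive_within]. *)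
Definition has_diff (R : realType) (V : normedModType R) (A : set V)
    (f : V -> R) (p : V) (df : V -> R) : Prop :=
  lform df /\ forall v, quotient_within A f p v --> df v.

(** * Calculus on a slab

    The set [tau^-1 [t0, t1]] for a linear form [tau] covers both uses: the time
    interval itself ([tau] the identity) and the jet spaces ([tau] the time). *)

Section Slab.
Context (R : realType) (V : normedModType R) (tau : V -> R) (t0 t1 : R).
Hypothesis tau_lin : lform tau.
Hypothesis t01 : t0 < t1.

Let A : set V := [set z | tau z \in `[t0, t1]].

(** From any point of the slab a short move along [v] or along [- v] stays inside:
    move towards the farther wall. Limits along admissible increments are thus
    unique, boundary points included. *)
Lemma slab_proper p v : A p ->
  ProperFilter (within [set h : R | A (h *: v + p)] 0^').
Proof.
move=> Ap; apply: Build_ProperFilter.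
rewrite /within/= => -[e /= e0 He].
have [d [d0 de dA]] : exists d : R, [/\ d != 0, `|d| < e & A (d *: v + p)].
  move: Ap; rewrite /A/= !in_itv/= => /andP[p0 p1].
  have w0 : 0 < `|tau v| + 1.
    by have := normr_ge0 (tau v); lra.
  pose d := Num.min (e / 2) ((t1 - t0) / 2 / (`|tau v| + 1)).
  have d0 : 0 < d by rewrite lt_min !divr_gt0 ?subr_gt0.
  have de : d < e by rewrite gt_min ltr_pdivrMr // ltr_pMr // ltr1n.
  have dv : d * `|tau v| <= (t1 - t0) / 2.
    have : d * (`|tau v| + 1) <= (t1 - t0) / 2.
      by rewrite -ler_pdivlMr // ge_min lexx orbT.
    by apply: le_trans; rewrite ler_pM2l // lerDl.
  pose m := (t0 + t1) / 2.
  pose s : R := if 0 <= tau v then 1 else -1.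
  have ss : s * tau v = `|tau v|.
    rewrite /s; case: ifPn => h; first by rewrite mul1r ger0_norm.
    by rewrite mulN1r ltr0_norm // ltNge.
  have s1 : `|s| = 1 by rewrite /s; case: ifP; rewrite ?normrN normr1.
  have s0 : s != 0 by rewrite -normr_eq0 s1 oner_eq0.
  have [pm|mp] := leP (tau p) m.
    exists (d * s); split; first by rewrite mulf_neq0 // gt_eqF.
      by rewrite normrM s1 mulr1 gtr0_norm.
    rewrite in_itv/= tau_lin -mulrA ss.
    have : 0 <= d * `|tau v| by rewrite mulr_ge0 // ltW.
    by move: pm dv; rewrite /m; set w := d * _; lra.
  exists (- (d * s)); split; first by rewrite oppr_eq0 mulf_neq0 // gt_eqF.
    by rewrite normrN normrM s1 mulr1 gtr0_norm.
  rewrite in_itv/= tau_lin mulNr -mulrA ss.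
  have : 0 <= d * `|tau v| by rewrite mulr_ge0 // ltW.
  by move: mp dv; rewrite /m; set w := d * _; lra.
by apply: (He d) => //=; rewrite sub0r normrN.
Qed.

Lemma derive_within_lim (W : normedModType R) (f : V -> W) p v l : A p ->
  quotient_within A f p v --> l -> derive_within A v f p = l.
Proof.
by move=> /(@slab_proper p v) pf fl; apply: cvg_lim => //; exact: norm_hausdorff.
Qed.

Lemma slab_convex p v s : A p -> A (v + p) -> 0 <= s -> s <= 1 ->
  A (s *: v + p).
Proof.
rewrite /A/= !in_itv/= tau_lin lformD // => /andP[a b] /andP[c d] s0 s1.
apply/andP; split; nra.
Qed.

Lemma derive_withinZ (W : normedModType R) (f : V -> W) p v c : A p ->
  (forall v, derivable_within A f p v) ->
  derive_within A (c *: v) f p = c *: derive_within A v f p.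
Proof.
move=> Ap df; apply: derive_within_lim => //.
(* For c != 0 substitute the increment h * c for h in the quotient along v. *)
have [->|c0] := eqVneq c 0.
  rewrite !scale0r; apply: cvg_near_cst; near=> h.
  by rewrite /= scaler0 add0r subrr scaler0.
have := derive_within_cvg (df v).
rewrite /quotient_within => H.
have Hc : h * c @[h --> within [set h : R | A (h *: (c *: v) + p)] 0^'] -->
          within [set h : R | A (h *: v + p)] 0^'.
  move=> P; rewrite /within/= => -[e /= e0 He]; exists (e / `|c|) => /=.
    by rewrite divr_gt0 // normr_gt0.
  move=> h /=; rewrite sub0r normrN => he h0; rewrite scalerA => hA.
  apply: He => //=; last by rewrite mulf_neq0.
  by rewrite sub0r normrN normrM -ltr_pdivlMr // normr_gt0.
have := @cvg_comp _ _ _ _ _ _ _ _ Hc H.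
move=> /(cvgZ (cvg_cst c)); apply: cvg_trans; apply: near_eq_cvg.
near=> h => /=; rewrite !scalerA.
have h0 : h != 0 by near: h; exact: near_admissible_neq0.
by rewrite invfM mulrCA mulfV // mulr1.
Unshelve. all: by end_near. Qed.

Let Ainterval p v (s : R) : A p -> A (v + p) -> s \in `]0, 1[ ->
  \forall h \near (0 : R)^', A (h *: v + (s *: v + p)).
Proof.
move=> Ap Avp; rewrite in_itv/= => /andP[s0 s1].
near=> h; rewrite addrA -scalerDl.
have hs : `|h| < Num.min s (1 - s).
  by near: h; apply: dnbhs0_lt; rewrite lt_min s0 subr_gt0.
move: hs; rewrite lt_min !ltr_norml => /andP[/andP[? ?] /andP[? ?]].
by apply: slab_convex => //; lra.
Unshelve. all: by end_near. Qed.

(** At interior parameters of a segment contained in the slab the derivative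
    relative to the slab is an ordinary one-variable derivative, so the usual mean
    value theorem applies even when the segment runs inside a wall. *)
Lemma mvt_within (f : V -> R) p v :
  {within A, continuous f} -> (forall q, A q -> derivable_within A f q v) ->
  A p -> A (v + p) ->
  exists s, [/\ s \in `]0, 1[, A (s *: v + p) &
    f (v + p) - f p = derive_within A v f (s *: v + p)].
Proof.
move=> cf df Ap Avp.
have As (s : R) : s \in `[0, 1] -> A (s *: v + p).
  by rewrite in_itv/= => /andP[s0 s1]; exact: slab_convex.
pose phi s := f (s *: v + p).
have dphi (s : R) : s \in `]0, 1[ ->
    is_derive s 1 phi (derive_within A v f (s *: v + p)).
  move=> s01; have Asp : A (s *: v + p).
    by apply: As; apply: subset_itv_oo_cc s01.
  have : (h^-1 *: (phi (h *: 1 + s) - phi s)) @[h --> 0^'] -->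
         derive_within A v f (s *: v + p).
    have H := derive_within_cvg (df _ Asp).
    move=> P /H HP.
    change (\forall h \near (0 : R)^', P (h^-1 * (phi (h * 1 + s) - phi s))).
    have {}HP : \forall h \near (0 : R)^', A (h *: v + (s *: v + p)) ->
      P (h^-1 * (f (h *: v + (s *: v + p)) - f (s *: v + p))) by exact: HP.
    near=> h; rewrite mulr1 /phi scalerDl -addrA.
    have : A (h *: v + (s *: v + p)) by near: h; exact: Ainterval.
    by near: h; exact: HP.
  move=> H; apply: DeriveDef; first exact: cvgP H.
  by apply: cvg_lim => //; exact: norm_hausdorff.
have cphi : {within `[0, 1], continuous phi}.
  apply/subspace_continuousP => x x01.
  move/subspace_continuousP : cf => /(_ _ (As _ x01)).
  apply: cvg_comp => P; rewrite /within/= => HP.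
  have : (s : R) *: v + p @[s --> x] --> x *: v + p.
    by apply: cvgD; [apply: cvgZ; [exact: cvg_id|exact: cvg_cst]|exact: cvg_cst].
  move=> /(_ _ HP) H.
  have {}H : \forall y \near x, A (y *: v + p) -> P (y *: v + p) by exact: H.
  change (\forall y \near x, y \in `[0, 1] -> P (y *: v + p)).
  by near=> y => /As; near: y; exact: H.
have [s s01] := MVT ltr01 dphi cphi.
rewrite subr0 mulr1 {1 2}/phi scale1r scale0r add0r => E.
by exists s; split => //; apply: As; apply: subset_itv_oo_cc s01.
Unshelve. all: by end_near. Qed.

(** Additivity in the direction: go from [p] to [p + h (u + v)] through [p + h u]
    or [p + h v], treat the second leg by the mean value theorem, and let its
    derivative tend to the one at [p] by continuity. At least one of the two
    intermediate points lies in the slab when [h] is small, so that boundary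
    points need no separate treatment. *)
Lemma C1_has_diff (f : V -> R) p :
  {within A, continuous f} ->
  (forall q v, A q -> derivable_within A f q v) ->
  (forall v, {within A, continuous (derive_within A v f)}) ->
  A p -> has_diff A f p (fun v => derive_within A v f p).
Proof.
move=> cf df cdf Ap; split; last by move=> v; exact: derive_within_cvg (df _ _ Ap).
have dZ q v c : A q -> derive_within A (c *: v) f q = c * derive_within A v f q.
  by move=> Aq; rewrite derive_withinZ // => w; exact: df.
move=> a u' v; rewrite -dZ //; set u := a *: u'.
(* The second leg, from p + h x to p + h (x + y). *)
have half x y e : 0 < e -> \forall h \near (0 : R)^', A (h *: x + p) ->
    A (h *: (x + y) + p) ->
    `|derive_within A y f p - h^-1 * (f (h *: (x + y) + p) - f (h *: x + p))| < e.
  move=> e0; have /subspace_continuousP/(_ p Ap) := cdf y.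
  move=> /cvgrPdist_lt/(_ e e0); rewrite near_withinE => /nbhs_ballP[r /= r0 Hr].
  near=> h => Ahx Ahxy.
  have h0 : h != 0 by near: h; exact: nbhs_dnbhs_neq.
  have Exy : h *: (x + y) + p = h *: y + (h *: x + p).
    by rewrite scalerDr addrA [h *: y + _]addrC.
  rewrite Exy in Ahxy *.
  have [s [s01 As ->]] := mvt_within cf (df^~ (h *: y)) Ahx Ahxy.
  rewrite dZ // mulKf //; apply: Hr => //.
  rewrite -ball_normE /= addrA opprD addrCA subrr addr0 normrN.
  move: s01; rewrite in_itv/= => /andP[s0 s1].
  have hr : `|h| < r / (`|x| + `|y| + 1).
    by near: h; apply: dnbhs0_lt; rewrite divr_gt0 // ltr_wpDl.
  move: hr; rewrite ltr_pdivlMr ?ltr_wpDl // => hr.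
  rewrite (le_lt_trans _ hr) // (le_trans (ler_normD _ _)) // !normrZ.
  rewrite (gtr0_norm s0).
  have := normr_ge0 h; have := normr_ge0 x; have := normr_ge0 y.
  set H := `|h|; set X := `|x|; set Y := `|y| => Y0 X0 H0.
  have : s * (H * Y) <= H * Y by rewrite ler_piMl ?mulr_ge0 // ltW.
  lra.
(* If t + a + b is in [t0, t1] then so is t + a or t + b, as soon as |a| and |b|
   are less than half of t1 - t0. *)
have side x y : \forall h \near (0 : R)^', A (h *: (x + y) + p) ->
    A (h *: x + p) \/ A (h *: y + p).
  near=> h.
  have hr : `|h| < (t1 - t0) / 2 / (`|tau x| + `|tau y| + 1).
    by near: h; apply: dnbhs0_lt; rewrite !divr_gt0 ?subr_gt0 // ltr_wpDl.
  move: hr; rewrite ltr_pdivlMr ?ltr_wpDl // => hr.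
  have hx : `|h * tau x| < (t1 - t0) / 2.
    rewrite (le_lt_trans _ hr) // normrM ler_wpM2l //.
    by rewrite -addrA lerDl.
  have hy : `|h * tau y| < (t1 - t0) / 2.
    rewrite (le_lt_trans _ hr) // normrM ler_wpM2l //.
    by rewrite addrAC lerDr.
  move: hx hy Ap; rewrite /A/= !in_itv/= !tau_lin (lformD x y tau_lin) mulrDr.
  rewrite !ltr_norml => /andP[x1 x2] /andP[y1 y2] /andP[p1 p2] /andP[q1 q2].
  have [a1|a1] := ltP (h * tau x + tau p) t0; first by right; apply/andP; lra.
  have [a2|a2] := ltP t1 (h * tau x + tau p); first by right; apply/andP; lra.
  by left.
apply: derive_within_lim => //; apply/cvgrPdist_lt => e e0.
have e20 : 0 < e / 2 by rewrite divr_gt0.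
have quot x : \forall h \near (0 : R)^', A (h *: x + p) ->
    `|derive_within A x f p - h^-1 * (f (h *: x + p) - f p)| < e / 2.
  by have /cvgrPdist_lt/(_ _ e20) := derive_within_cvg (df p x Ap).
have path x y : \forall h \near (0 : R)^', A (h *: x + p) ->
    A (h *: (x + y) + p) ->
    `|derive_within A x f p + derive_within A y f p
      - h^-1 * (f (h *: (x + y) + p) - f p)| < e.
  near=> h => Ax Axy.
  have H1 : `|derive_within A x f p - h^-1 * (f (h *: x + p) - f p)| < e / 2.
    by move: Ax; near: h; exact: quot.
  have H2 : `|derive_within A y f p -
      h^-1 * (f (h *: (x + y) + p) - f (h *: x + p))| < e / 2.
    by move: Ax Axy; near: h; exact: half.
  rewrite [e]splitr; apply: le_lt_trans (ltrD H1 H2).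
  apply: le_trans (ler_normD _ _).
  by rewrite le_eqVlt; apply/orP; left; apply/eqP; congr `|_|; ring.
have pathvu := path v u; rewrite (addrC v u) in pathvu.
apply: near_admissible; near=> h => Auv.
have : A (h *: u + p) \/ A (h *: v + p).
  by move: Auv; near: h; exact: side.
case=> Aw; first by move: Aw Auv; near: h; exact: path.
rewrite [derive_within A u f p + _]addrC.
by move: Aw Auv; near: h; exact: pathvu.
Unshelve. all: by end_near. Qed.

End Slab.

(** * Rules for differentials *)

Lemma cvg_near_eq (T : Type) (U : topologicalType) (F : set_system T)
    (f g : T -> U) (l : U) : Filter F ->
  (\forall x \near F, f x = g x) -> f x @[x --> F] --> l -> g x @[x --> F] --> l.
Proof. by move=> FF H; apply: cvg_trans; apply: near_eq_cvg. Qed.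

Lemma cvg_quotient_eq (R : realType) (V W : normedModType R) (A : set V)
    (f : V -> W) (p v : V) (g : R -> W) (l : W) :
  (\forall h \near within [set h : R | A (h *: v + p)] 0^',
     g h = h^-1 *: (f (h *: v + p) - f p)) ->
  g h @[h --> within [set h : R | A (h *: v + p)] 0^'] --> l ->
  quotient_within A f p v --> l.
Proof. by move=> H; exact: cvg_near_eq. Qed.

Section DiffRules.
Context (R : realType) (V : normedModType R) (A : set V) (p : V).
Implicit Types (f g df dg l : V -> R).

Lemma has_diff_eq f df dg : has_diff A f p df -> df =1 dg -> has_diff A f p dg.
Proof. by move=> + /funext <-. Qed.

Lemma has_diff_fun_eq f g df : (forall q, A q -> f q = g q) -> A p ->
  has_diff A f p df -> has_diff A g p df.
Proof.
move=> fg Ap [ldf fdf]; split=> // v.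
by rewrite -(eq_quotient_within v fg Ap); exact: fdf.
Qed.

Lemma has_diff_lform l : lform l -> has_diff A l p l.
Proof.
move=> ll; split=> // v; apply: cvg_near_cst; near=> h.
have h0 : h != 0 by near: h; exact: near_admissible_neq0.
rewrite /= ll addrK; exact: mulKf.
Unshelve. all: by end_near. Qed.

Lemma has_diff_cst (c : R) : has_diff A (fun=> c) p (fun=> 0).
Proof.
split=> [a u v|v]; first by rewrite mulr0 addr0.
apply: cvg_near_cst; near=> h; rewrite /= subrr; exact: mulr0.
Unshelve. all: by end_near. Qed.

Lemma has_diffD f g df dg : has_diff A f p df -> has_diff A g p dg ->
  has_diff A (fun z => f z + g z) p (fun v => df v + dg v).
Proof.
move=> [lf Hf] [lg Hg]; split=> [a u v|v]; first by rewrite lf lg; ring.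
have FF := admissible_filter A p v.
have := @cvgD _ _ _ _ FF _ _ _ _ (Hf v) (Hg v); apply: cvg_quotient_eq; near=> h.
by rewrite /= -scalerDr; congr (_ *: _); ring.
Unshelve. all: by end_near. Qed.

Lemma has_diffM f g df dg : has_diff A f p df -> has_diff A g p dg ->
  has_diff A (fun z => f z * g z) p (fun v => df v * g p + f p * dg v).
Proof.
move=> [lf Hf] [lg Hg]; split=> [a u v|v]; first by rewrite lf lg; ring.
have FF := admissible_filter A p v.
(* Gateaux differentiability gives continuity along each line, which is all that
   the product rule needs. *)
have gp : g (h *: v + p) @[h --> within [set h : R | A (h *: v + p)] 0^'] --> g p.
  have H := @cvgD _ _ _ _ FF _ _ _ _ (@cvg_cst _ (g p) _ _ FF)
    (@cvgM _ _ _ FF _ _ _ _ (@admissible_to0 _ _ A p v) (Hg v)).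
  rewrite mul0r addr0 in H; apply: (cvg_near_eq FF _ H); near=> h.
  have h0 : h != 0 by near: h; exact: near_admissible_neq0.
  rewrite /= -[_ *: _]/(h^-1 * (g (h *: v + p) - g p)).
  by rewrite [_ * (_ * _)]mulVKf // addrC subrK.
have := @cvgD _ _ _ _ FF _ _ _ _ (@cvgM _ _ _ FF _ _ _ _ (Hf v) gp)
  (@cvgM _ _ _ FF _ _ _ _ (@cvg_cst _ (f p) _ _ FF) (Hg v)).
apply: cvg_quotient_eq; near=> h => /=.
rewrite -![_ *: (f _ - _)]/(h^-1 * (f (h *: v + p) - f p)).
rewrite -![_ *: (g _ - _)]/(h^-1 * (g (h *: v + p) - g p)).
rewrite -![_ *: (_ * _ - _)]/(h^-1 * _).
by ring.
Unshelve. all: by end_near. Qed.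

Lemma has_diff_sum (I : Type) (r : seq I) (F dF : I -> V -> R) :
  (forall i, has_diff A (F i) p (dF i)) ->
  has_diff A (fun z => \sum_(i <- r) F i z) p (fun v => \sum_(i <- r) dF i v).
Proof.
move=> H; elim: r => [|i r IH].
  have := has_diff_cst 0; congr has_diff; last by apply/funext=> z; rewrite big_nil.
  by apply/funext=> z; rewrite big_nil.
have := has_diffD (H i) IH; congr has_diff;
  by apply/funext=> z; rewrite big_cons.
Qed.

End DiffRules.

(** A linear map that pulls the set back also pulls back the admissible
    increments, so the two quotients agree exactly. *)
Lemma quotient_within_comp_linear (R : realType) (V V' W : normedModType R)
    (A : set V') (pi : V -> V') (f : V' -> W) (p v : V) : linear pi ->
  quotient_within (pi @^-1` A) (f \o pi) p v = quotient_within A f (pi p) (pi v).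
Proof.
move=> lpi; rewrite /quotient_within.
rewrite (_ : [set h | A (h *: pi v + pi p)] =
             [set h | (pi @^-1` A) (h *: v + p)]); last first.
  by apply/seteqP; split=> h /=; rewrite lpi.
rewrite (_ : (fun h => h^-1 *: (f (h *: pi v + pi p) - f (pi p))) =
             (fun h => h^-1 *: ((f \o pi) (h *: v + p) - (f \o pi) p))) //.
by apply/funext=> h /=; rewrite lpi.
Qed.

Lemma has_diff_comp (R : realType) (V V' : normedModType R) (A : set V')
    (pi : V -> V') (f df : V' -> R) (p : V) :
  linear pi -> has_diff A f (pi p) df ->
  has_diff (pi @^-1` A) (f \o pi) p (df \o pi).
Proof.
move=> lpi [ldf Hf]; split=> [a u v|v] /=; first by rewrite lpi ldf.
by rewrite (quotient_within_comp_linear _ _ _ _ lpi); exact: Hf.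
Qed.

Lemma cvg_quotient_linear (R : realType) (V W W' : normedModType R) (A : set V)
    (phi : W -> W') (f : V -> W) (p v : V) :
  linear phi -> continuous phi -> derivable_within A f p v ->
  quotient_within A (phi \o f) p v --> phi (derive_within A v f p).
Proof.
move=> lphi cphi df.
have phiZB a x y : phi (a *: (x - y)) = a *: (phi x - phi y).
  have phi0 : phi 0 = 0.
    by have := lphi (-1) 0 0; rewrite scaler0 addr0 scaleN1r addrC subrr.
  have phiZ b w : phi (b *: w) = b *: phi w.
    by rewrite -[b *: w]addr0 lphi phi0 addr0.
  by rewrite phiZ -scaleN1r addrC lphi scaleN1r addrC.
have H : phi (h^-1 *: (f (h *: v + p) - f p))
    @[h --> within [set h : R | A (h *: v + p)] 0^'] -->
    phi (derive_within A v f p).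
  exact: (@cvg_comp _ _ _ _ phi _ _ _ (derive_within_cvg df) (cphi _)).
apply: (cvg_quotient_eq _ H); near=> h.
by rewrite /= phiZB.
Unshelve. all: by end_near. Qed.

(** * The exterior derivative of a one-form *)

Section ExtDerive.
Context (R : realType) (V : normedModType R) (A : set V).
Context (om : V -> V -> R) (z : V).
Hypothesis om_lin : forall q, lform (om q).
Hypothesis om_diff : forall v,
  has_diff A (om ^~ v) z (fun u => derive_within A u (om ^~ v) z).
Hypothesis adm : forall v, ProperFilter (within [set h : R | A (h *: v + z)] 0^').

Lemma ext_derivexx u : ext_derive A om z u u = 0.
Proof. exact: subrr. Qed.

Lemma ext_deriveC u v : ext_derive A om z u v = - ext_derive A om z v u.
Proof. by rewrite /ext_derive opprB. Qed.

Lemma ext_derive_lformr u : lform (ext_derive A om z u).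
Proof.
move=> a v w; rewrite /ext_derive.
rewrite (om_diff u).1.
have -> : derive_within A u (om ^~ (a *: v + w)) z =
  a * derive_within A u (om ^~ v) z + derive_within A u (om ^~ w) z.
  have -> : om ^~ (a *: v + w) = (fun q => a * om q v + om q w).
    by apply/funext => q; rewrite om_lin.
  have := has_diffD (has_diffM (has_diff_cst A z a) (om_diff v)) (om_diff w).
  move=> /proj2/(_ u); rewrite mul0r add0r => H.
  by apply: cvg_lim => //; exact: norm_hausdorff.
ring.
Qed.

Lemma ext_derive_lforml v : lform (ext_derive A om z ^~ v).
Proof.
move=> a u w; rewrite ext_deriveC (ext_derive_lformr v) !(ext_deriveC _ v).
by ring.
Qed.

End ExtDerive.

(** * Coordinates on jet spaces *)

Section JetAlgebra.
Context (R : realType) (n k : nat).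

Lemma lform_fst : lform (fst : jet R n k -> R).
Proof. by []. Qed.

Lemma lform_coord i j : lform (fun z : jet R n k => z.2 i j).
Proof. by move=> a u v; rewrite /= !mxE. Qed.

Lemma linear_jproj : linear (@jproj R n k).
Proof.
move=> a u v; rewrite /jproj; congr (_, _).
by apply/matrixP=> i j; rewrite !mxE.
Qed.

Lemma lift_ord_max_inord i : (i <= k)%N ->
  lift ord_max (inord i : 'I_k.+1) = inord i :> 'I_k.+2.
Proof.
by move=> ik; apply: ord_inj; rewrite lift_max !inordK // ltnS // (leq_trans ik).
Qed.

Lemma lift_ord0_inord i : (i <= k)%N ->
  lift ord0 (inord i : 'I_k.+1) = inord i.+1 :> 'I_k.+2.
Proof. by move=> ik; apply: ord_inj; rewrite lift0 !inordK // ltnS. Qed.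

Lemma lform_vertical (l : jet R n k -> R) (w : jet R n k) : lform l ->
  w.1 = 0 -> l w = \sum_(i < k.+1) \sum_(j < n) w.2 i j * l (0, delta_mx i j).
Proof.
move=> ll; case: w => s M /= ->.
pose l' (N : 'M[R]_(k.+1, n)) := l (0, N).
have ll' : lform l'.
  move=> a N N'; rewrite /l' -ll; congr l.
  by rewrite [RHS]/GRing.add /=; congr (_, _); rewrite /= scaler0 addr0.
rewrite -[LHS]/(l' M) {1}[M]matrix_sum_delta lform_sum //.
apply: eq_bigr => i _; rewrite lform_sum //.
by apply: eq_bigr => j _; rewrite lformZ.
Qed.

End JetAlgebra.

(** * Calculus on jet spaces *)

Section JetCalculus.
Context (R : realType) (n : nat) (t0 t1 : R).
Hypothesis t01 : t0 < t1.

Lemma jets_derive_within k f df z v : jets n k t0 t1 z ->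
  has_diff (jets n k t0 t1) f z df ->
  derive_within (jets n k t0 t1) v f z = df v.
Proof.
move=> Jz [_ H].
by apply: (@derive_within_lim _ _ fst t0 t1 (@lform_fst R n k) t01).
Qed.

Lemma smooth_on_derive_within (V W : normedModType R) (A : set V)
    (f : V -> W) v : smooth_on A f -> smooth_on A (derive_within A v f).
Proof. by move=> sf vs; have := sf (rcons vs v); rewrite foldr_rcons. Qed.

Lemma smooth_has_diff k (f : jet R n k -> R) z :
  smooth_on (jets n k t0 t1) f -> jets n k t0 t1 z ->
  has_diff (jets n k t0 t1) f z (fun v => derive_within (jets n k t0 t1) v f z).
Proof.
move=> sf; apply: (@C1_has_diff _ _ fst t0 t1 (@lform_fst R n k) t01).
- exact: (sf [::]).1.
- by move=> q v; apply: (sf [::]).2.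
- by move=> v; have [] := sf [:: v].
Qed.

(** The projection pulls [J^k] back to [J^(k+1)], both being cut out by the same
    condition on the time. *)
Lemma has_diff_jproj k (f df : jet R n k -> R) (z : jet R n k.+1) :
  has_diff (jets n k t0 t1) f (jproj z) df ->
  has_diff (jets n k.+1 t0 t1) (fun q => f (jproj q)) z (fun v => df (jproj v)).
Proof. exact/has_diff_comp/linear_jproj. Qed.

(** The direction [(1, xdot, xddot, ...)] of the total derivative at [z]; on a
    prolonged curve it is the velocity of the projected curve. *)
Definition total_vec k (z : jet R n k.+1) : jet R n k := (1, row' ord0 z.2).

Section TotalDerivative.
Context (k : nat) (f : jet R n k -> R).
Hypothesis sf : smooth_on (jets n k t0 t1) f.
Let J := jets n k t0 t1.
Let J1 := jets n k.+1 t0 t1.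

(** The direction of a total derivative varies with the point. Expanding it in
    coordinates gives a sum of products of smooth functions, to which the rules
    for differentials apply. *)
Lemma total_deriveE z : J1 z -> total_derive t0 t1 f z =
  derive_within J (1, 0) f (jproj z) +
  \sum_(i < k.+1) \sum_(j < n)
    z.2 (lift ord0 i) j * derive_within J (0, delta_mx i j) f (jproj z).
Proof.
move=> Jz; have [ll _] := smooth_has_diff sf (z := jproj z) Jz.
rewrite /total_derive.
have -> : ((1, row' ord0 z.2) : jet R n k) = (1, 0) + (0, row' ord0 z.2).
  by rewrite [RHS]/GRing.add /=; congr (_, _); rewrite /= ?addr0 ?add0r.
rewrite (lformD _ _ ll); congr (_ + _).
rewrite (lform_vertical ll) //.
by apply: eq_bigr => i _; apply: eq_bigr => j _; rewrite /= mxE.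
Qed.

(** The second part concerns the highest derivatives, which the total derivative
    of [f] contains only linearly, with the corresponding partial derivatives of
    [f] as coefficients. *)
Lemma total_derive_has_diff z : J1 z ->
  has_diff J1 (total_derive t0 t1 f) z
    (fun w => derive_within J1 w (total_derive t0 t1 f) z) /\
  (forall w : jet R n k.+1, jproj w = 0 ->
    derive_within J1 w (total_derive t0 t1 f) z =
    derive_within J (0, row' ord0 w.2) f (jproj z)).
Proof.
move=> Jz; have [ll _] := smooth_has_diff sf (z := jproj z) Jz.
have dP v := has_diff_jproj
  (smooth_has_diff (smooth_on_derive_within v sf) (z := jproj z) Jz).
have H := has_diffD (dP (1, 0)) (has_diff_sum (index_enum _) (fun i =>
  has_diff_sum (index_enum _) (fun j => has_diffM
    (has_diff_lform J1 z (@lform_coord R n k.+1 (lift ord0 i) j))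
    (dP (0, delta_mx i j))))).
have {}H := has_diff_fun_eq (fun q Jq => esym (total_deriveE Jq)) Jz H.
split; first by apply: (has_diff_eq H) => w; rewrite (jets_derive_within _ Jz H).
move=> w w0; rewrite (jets_derive_within _ Jz H) w0.
have d0 v : derive_within J 0 (derive_within J v f) (jproj z) = 0.
  exact: lform0 (smooth_has_diff (smooth_on_derive_within v sf) (z := jproj z) Jz).1.
rewrite d0 add0r (lform_vertical ll) //.
apply: eq_bigr => i _; apply: eq_bigr => j _; rewrite /= mxE d0.
by rewrite mulr0 addr0.
Qed.

End TotalDerivative.
End JetCalculus.

(** * Contracting the differential of the Cartan form *)

Lemma sum_ord3 (R : realType) (F : 'I_3 -> R) :
  \sum_(i < 3) F i = F (inord 0) + F (inord 1) + F (inord 2).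
Proof.
rewrite !big_ord_recl big_ord0 addr0 addrA.
by congr (F _ + F _ + F _); apply: ord_inj; rewrite /= inordK.
Qed.

Section Cartan.
Context (R : realType) (n : nat) (t0 t1 : R) (L : jet R n 2 -> R).
Hypothesis t01 : t0 < t1.
Hypothesis sL : smooth_on (jets n 2 t0 t1) L.
Let J2 := jets n 2 t0 t1.
Let J3 := jets n 3 t0 t1.
Let Theta := cartan_form t0 t1 L.
Let D w (f : jet R n 3 -> R) z := derive_within J3 w f z.
Let P1 j := momentum_x t0 t1 L j.
Let P2 j := momentum_xdot t0 t1 L j.
Let Lxdd j := pd t0 t1 2 j L.

Lemma smooth_pd i j : smooth_on J2 (pd t0 t1 i j L).
Proof. exact: smooth_on_derive_within. Qed.

Lemma has_diff_self (f df : jet R n 3 -> R) z : J3 z ->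
  has_diff J3 f z df -> has_diff J3 f z (fun w => D w f z).
Proof.
by move=> Jz H; apply: (has_diff_eq H) => w; rewrite /D (jets_derive_within t01 _ Jz H).
Qed.

Lemma momentum_xdot_has_diff j z : J3 z ->
  has_diff J3 (P2 j) z (fun w => derive_within J2 (jproj w) (Lxdd j) (jproj z)).
Proof.
move=> Jz; exact: (has_diff_jproj
  (smooth_has_diff t01 (smooth_pd 2 j) (z := jproj z) Jz)).
Qed.

Lemma momentum_x_has_diff j z : J3 z ->
  has_diff J3 (P1 j) z (fun w =>
    derive_within J2 (jproj w) (pd t0 t1 1 j L) (jproj z)
    - D w (total_derive t0 t1 (Lxdd j)) z).
Proof.
move=> Jz.
have H1 := has_diff_jproj
  (smooth_has_diff t01 (smooth_pd 1 j) (z := jproj z) Jz).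
have [H2 _] := total_derive_has_diff t01 (smooth_pd 2 j) Jz.
have := has_diffD H1 (has_diffM (has_diff_cst J3 z (-1)) H2).
congr has_diff; apply/funext => w; first by rewrite mulN1r.
by rewrite mul0r add0r mulN1r.
Qed.

(** The value on [v] of the contact form [d x^(i) - x^(i+1) dt]. *)
Definition contact (z v : jet R n 3) i j : R :=
  v.2 (inord i) j - z.2 (inord i.+1) j * v.1.

Lemma cartan_form_lform z : lform (Theta z).
Proof.
have E v : Theta z v = L (jproj z) * v.1
  + \sum_(j < n) P1 j z * contact z v 0 j
  + \sum_(j < n) P2 j z * contact z v 1 j by [].
move=> a u v; rewrite !E !mulrDr !mulr_sumr [RHS]addrACA [X in _ = X + _]addrACA.
rewrite -!big_split /=; congr (_ + _ + _);
  first by rewrite -[_ *: _]/(a * u.1); ring.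
  by apply: eq_bigr => j _; rewrite /contact !mxE /= -[_ *: _]/(a * u.1); ring.
by apply: eq_bigr => j _; rewrite /contact !mxE /= -[_ *: _]/(a * u.1); ring.
Qed.

Lemma cartan_form_has_diff z v : J3 z -> has_diff J3 (Theta ^~ v) z (fun u =>
  derive_within J2 (jproj u) L (jproj z) * v.1
  + \sum_(j < n) (D u (P1 j) z * contact z v 0 j - P1 j z * (u.2 (inord 1) j * v.1))
  + \sum_(j < n) (D u (P2 j) z * contact z v 1 j - P2 j z * (u.2 (inord 2) j * v.1))).
Proof.
move=> Jz.
have HL := has_diff_jproj (smooth_has_diff t01 sL (z := jproj z) Jz).
have Hcontact i j : has_diff J3 (fun q => v.2 (inord i) j - q.2 (inord i.+1) j * v.1) z
    (fun u => - (u.2 (inord i.+1) j * v.1)).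
  have H := has_diff_lform J3 z (@lform_coord R n 3 (inord i.+1) j).
  have := has_diffD (has_diff_cst J3 z (v.2 (inord i) j))
    (has_diffM H (has_diff_cst J3 z (- v.1))).
  congr has_diff; apply/funext=> w; first by rewrite mulrN.
  by rewrite mulr0 addr0 add0r mulrN.
have H1 j := has_diffM (has_diff_self Jz (momentum_x_has_diff j Jz)) (Hcontact 0%N j).
have H2 j := has_diffM (has_diff_self Jz (momentum_xdot_has_diff j Jz)) (Hcontact 1%N j).
have := has_diffD (has_diffD (has_diffM HL (has_diff_cst J3 z v.1))
  (has_diff_sum (index_enum _) H1)) (has_diff_sum (index_enum _) H2).
congr has_diff; apply/funext=> w.
rewrite mulr0 addr0; congr (_ + _ + _); apply: eq_bigr => j _; rewrite mulrN //.
Qed.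

(** Among the components of [w] along [xddot] the momentum [p_xdot] cancels
    [L_xddot]; along [xdot] the momentum [p_x] cancels [L_xdot] and leaves the
    total derivative of [L_xddot]. *)
Lemma ext_derive_cartan_vertical z u w : J3 z -> u.1 = 1 -> w.1 = 0 ->
  ext_derive J3 Theta z u w = \sum_(j < n)
   ((D u (P1 j) z - pd t0 t1 0 j L (jproj z)) * w.2 (inord 0) j
    + (D u (P2 j) z - total_derive t0 t1 (Lxdd j) z) * w.2 (inord 1) j
    - D w (P1 j) z * contact z u 0 j - D w (P2 j) z * contact z u 1 j).
Proof.
move=> Jz u1 w1; rewrite /ext_derive.
rewrite (jets_derive_within t01 _ Jz (cartan_form_has_diff w Jz)).
rewrite (jets_derive_within t01 _ Jz (cartan_form_has_diff u Jz)).
have [ll _] := smooth_has_diff t01 sL (z := jproj z) Jz.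
rewrite w1 u1 (lform_vertical (w := jproj w) ll) // sum_ord3.
rewrite [X in X + _ + _ - _]mulr0 add0r [X in _ - (X + _ + _)]mulr1.
rewrite -!big_split -sumrB /=.
apply: eq_bigr => j _.
rewrite /contact w1 !mxE !lift_ord_max_inord //.
have -> : P1 j z = pd t0 t1 1 j L (jproj z) - total_derive t0 t1 (Lxdd j) z by [].
have -> : P2 j z = pd t0 t1 2 j L (jproj z) by [].
rewrite u1 -!/(pd t0 t1 _ j L (jproj z)).
move: (D u (P1 j) z) (D u (P2 j) z) (D w (P1 j) z) (D w (P2 j) z) => a b c d.
move: (pd t0 t1 0 j L _) (pd t0 t1 1 j L _) (pd t0 t1 2 j L _) => l0 l1 l2.
move: (total_derive _ _ _ _) => e; ring.
Qed.

Lemma contact_total z u i j : u.1 = 1 -> (i <= 2)%N ->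
  (jproj u - total_vec z).2 (inord i) j = contact z u i j.
Proof.
move=> u1 i2; rewrite /contact /= !mxE u1 mulr1.
by rewrite lift_ord_max_inord // lift_ord0_inord.
Qed.

(** Both terms are derivatives of [L_xddot], along the projection of [u] and along
    the direction of the total derivative; these directions differ by the
    vertical vector with components the contact forms. *)
Lemma momentum_xdot_total z u j : J3 z -> u.1 = 1 ->
  D u (P2 j) z - total_derive t0 t1 (Lxdd j) z =
  \sum_(k < n) (contact z u 0 k * pd t0 t1 0 k (Lxdd j) (jproj z)
              + contact z u 1 k * pd t0 t1 1 k (Lxdd j) (jproj z)
              + contact z u 2 k * pd t0 t1 2 k (Lxdd j) (jproj z)).
Proof.
move=> Jz u1.
rewrite /D (jets_derive_within t01 _ Jz (momentum_xdot_has_diff j Jz)).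
rewrite /total_derive -/(total_vec z).
have [ll _] := smooth_has_diff t01 (smooth_pd 2 j) (z := jproj z) Jz.
rewrite -(lformB _ _ ll) (lform_vertical ll); last by rewrite /= u1 subrr.
rewrite sum_ord3 -!big_split; apply: eq_bigr => k _.
by rewrite !contact_total.
Qed.

Lemma ext_derive_cartan_holonomic z u w : J3 z -> u.1 = 1 -> w.1 = 0 ->
  (forall i j, (i <= 2)%N -> contact z u i j = 0) ->
  ext_derive J3 Theta z u w = \sum_(j < n)
    (D u (P1 j) z - pd t0 t1 0 j L (jproj z)) * w.2 (inord 0) j.
Proof.
move=> Jz u1 w1 c0; rewrite ext_derive_cartan_vertical //; apply: eq_bigr => j _.
have c00 k : contact z u 0 k = 0 by exact: c0.
have c01 k : contact z u 1 k = 0 by exact: c0.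
have c02 k : contact z u 2 k = 0 by exact: c0.
have -> : D u (P2 j) z - total_derive t0 t1 (Lxdd j) z = 0.
  rewrite momentum_xdot_total //; apply: big1 => k _.
  rewrite c00 c01 c02.
  move: (pd _ _ 0 _ _ _) (pd _ _ 1 _ _ _) (pd _ _ 2 _ _ _) => x y w'.
  by rewrite !mul0r !addr0.
by rewrite c00 c01 mul0r !mulr0 !subr0 addr0.
Qed.

Definition fibre_delta i (k : 'I_n) : jet R n 3 := (0, delta_mx (inord i) k).

Lemma row'_delta_mx (i : nat) k : (i <= 2)%N ->
  row' ord0 (delta_mx (inord i.+1 : 'I_4) k : 'M[R]_(4, n)) = delta_mx (inord i) k.
Proof.
by move=> i2; apply/matrixP => a b; rewrite !mxE -lift_ord0_inord //.
Qed.

Lemma jproj_fibre_delta i k : (i <= 2)%N ->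
  jproj (fibre_delta i k) = (0, delta_mx (inord i) k) :> jet R n 2.
Proof.
move=> i2; congr (_, _); apply/matrixP => a b.
by rewrite !mxE -lift_ord_max_inord // (inj_eq lift_inj).
Qed.

Lemma jproj_fibre_delta3 k : jproj (fibre_delta 3 k) = 0 :> jet R n 2.
Proof.
congr (_, _); apply/matrixP => a b; rewrite !mxE.
rewrite (_ : (inord 3 : 'I_4) = ord_max); last by apply: ord_inj; rewrite inordK.
by rewrite eq_sym (negbTE (neq_lift _ _)).
Qed.

Lemma fibre_delta_coord i j l k : (i <= 3)%N -> (j <= 3)%N ->
  (fibre_delta i k).2 (inord j) l = ((i == j) && (k == l))%:R.
Proof.
move=> i3 j3; rewrite mxE; congr ((_ && _)%:R); last by rewrite eq_sym.
by rewrite -(inj_eq val_inj) /= !inordK // eq_sym.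
Qed.

Lemma sum_delta (F : 'I_n -> R) k : \sum_(j < n) F j * (k == j)%:R = F k.
Proof.
rewrite (bigD1 k) //= eqxx mulr1 big1 ?addr0 // => j jk.
by rewrite eq_sym (negbTE jk) mulr0.
Qed.

(** The directions [xdddot], [xddot], [xdot] are used in this order: each one
    isolates the next contact form once the previous ones vanish, with the
    Hessian of [L] in [xddot] as its coefficient. *)
Lemma regular_contact z u : regular t0 t1 L -> J3 z -> u.1 = 1 ->
  (forall w, w.1 = 0 -> ext_derive J3 Theta z u w = 0) ->
  forall i j, (i <= 2)%N -> contact z u i j = 0.
Proof.
move=> reg Jz u1 H.
pose M : 'M[R]_n := \matrix_(i < n, j < n) pd t0 t1 2 j (Lxdd i) (jproj z).
have Mu : M \in unitmx by exact: reg.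
have Ml (x : 'I_n -> R) : (forall k, \sum_j x j * M j k = 0) -> forall j, x j = 0.
  move=> xM; have E : (\row_j x j) *m M = 0.
    by apply/rowP => k; rewrite !mxE -[RHS](xM k); apply: eq_bigr => j _; rewrite mxE.
  move=> j; have := congr1 (fun N => (N *m invmx M) 0 j) E.
  by rewrite /= mulmxK // mul0mx !mxE.
have Mr (x : 'I_n -> R) : (forall k, \sum_j M k j * x j = 0) -> forall j, x j = 0.
  move=> xM; have E : M *m (\col_j x j) = 0.
    apply/colP => k; rewrite !mxE -[RHS](xM k); apply: eq_bigr => j _.
    by congr (_ * _); rewrite mxE.
  move=> j; have := congr1 (fun N => (invmx M *m N) j 0) E.
  by rewrite /= mulKmx // mulmx0 !mxE.
have DP2 w j : D w (P2 j) z = derive_within J2 (jproj w) (Lxdd j) (jproj z).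
  by rewrite /D (jets_derive_within t01 w Jz (momentum_xdot_has_diff j Jz)).
have contract i k : (i <= 3)%N -> \sum_(j < n)
   ((D u (P1 j) z - pd t0 t1 0 j L (jproj z)) * ((i == 0%N) && (k == j))%:R
    + (D u (P2 j) z - total_derive t0 t1 (Lxdd j) z) * ((i == 1%N) && (k == j))%:R
    - D (fibre_delta i k) (P1 j) z * contact z u 0 j
    - D (fibre_delta i k) (P2 j) z * contact z u 1 j) = 0.
  move=> i3; rewrite -[RHS](H (fibre_delta i k) erefl).
  rewrite (ext_derive_cartan_vertical Jz u1) //; apply: eq_bigr => j _.
  by rewrite (@fibre_delta_coord i 0 j k i3 isT) (@fibre_delta_coord i 1 j k i3 isT).
have c0 j : contact z u 0 j = 0.
  move: j; apply: Ml => k; rewrite -[RHS](contract 3 k isT).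
  apply: eq_bigr => j _.
  have -> : D (fibre_delta 3 k) (P2 j) z = 0.
    rewrite DP2 jproj_fibre_delta3.
    exact: lform0 (smooth_has_diff t01 (smooth_pd 2 j) (z := jproj z) Jz).1.
  have -> : D (fibre_delta 3 k) (P1 j) z = - M j k.
    rewrite /D (jets_derive_within t01 _ Jz (momentum_x_has_diff j Jz)).
    rewrite jproj_fibre_delta3.
    rewrite (lform0 (smooth_has_diff t01 (smooth_pd 1 j) (z := jproj z) Jz).1).
    rewrite /D (total_derive_has_diff t01 (smooth_pd 2 j) Jz).2 ?jproj_fibre_delta3 //.
    by rewrite sub0r (@row'_delta_mx 2) // mxE.
  move: (M j k) (D u (P1 j) z - pd t0 t1 0 j L (jproj z))
    (D u (P2 j) z - total_derive t0 t1 (Lxdd j) z) => m a b /=; ring.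
have c1 j : contact z u 1 j = 0.
  move: j; apply: Ml => k; rewrite -[RHS]oppr0 -[X in _ = - X](contract 2 k isT) -sumrN.
  apply: eq_bigr => j _.
  have -> : D (fibre_delta 2 k) (P2 j) z = M j k.
    by rewrite DP2 jproj_fibre_delta // mxE.
  rewrite c0; move: (D (fibre_delta 2 k) (P1 j) z) (M j k)
    (D u (P1 j) z - pd t0 t1 0 j L (jproj z))
    (D u (P2 j) z - total_derive t0 t1 (Lxdd j) z).
  by move=> d m a b /=; ring.
have c2 j : contact z u 2 j = 0.
  move: j; apply: Mr => k; rewrite -[RHS](contract 1 k isT).
  (* View the left-hand side as a sum against the k-th unit vector. *)
  rewrite -[LHS]/((fun l => \sum_(j < n) M l j * contact z u 2 j) k) -sum_delta.
  apply: eq_bigr => j _; rewrite c0 c1.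
  have -> : D u (P2 j) z - total_derive t0 t1 (Lxdd j) z =
      \sum_(l < n) M j l * contact z u 2 l.
    rewrite momentum_xdot_total //; apply: eq_bigr => l _.
    rewrite c0 c1 mxE.
    move: (pd t0 t1 0 l (Lxdd j) _) (pd t0 t1 1 l (Lxdd j) _).
    by move: (pd t0 t1 2 l (Lxdd j) _) => x y w; ring.
  move: (D (fibre_delta 1 k) (P1 j) z) (D (fibre_delta 1 k) (P2 j) z)
    (D u (P1 j) z - pd t0 t1 0 j L (jproj z))
    (\sum_(l < n) M j l * contact z u 2 l).
  by move=> d e a b /=; ring.
by move=> [|[|[|i]]].
Qed.

End Cartan.

(** * Velocities and prolongations *)

Lemma jet_eq (R : realType) (n k : nat) (z z' : jet R n k) :
  z.1 = z'.1 -> (forall i j, z.2 i j = z'.2 i j) -> z = z'.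
Proof.
by case: z z' => [a M] [a' M'] /= -> MM'; congr (_, _); apply/matrixP.
Qed.

Lemma jproj_total_vec (R : realType) (n k : nat) (z : jet R n k.+2) :
  jproj (total_vec z) = total_vec (jproj z).
Proof.
congr (_, _); apply/matrixP => i j; rewrite !mxE; congr (z.2 _ j).
by apply: ord_inj; rewrite lift0 !lift_max lift0.
Qed.

Section Velocity.
Context (R : realType) (n k : nat) (t0 t1 : R).
Hypothesis t01 : t0 < t1.
Context (g : R -> jet R n k).
Hypothesis sg : smooth_section t0 t1 g.

Definition velocity t : jet R n k := derive_within `[t0, t1] (1 : R) g t.

Lemma derive_within_section (phi : jet R n k -> R) t : t \in `[t0, t1] ->
  linear phi -> continuous phi ->
  derive_within `[t0, t1] (1 : R) (phi \o g) t = phi (velocity t).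
Proof.
move=> It lphi cphi.
apply: (@derive_within_lim R R id t0 t1 _ t01) => //.
apply: cvg_quotient_linear => //.
by have [_ /(_ [::])[_]] := sg; apply.
Qed.

Lemma velocity_coord t i j : t \in `[t0, t1] -> (velocity t).2 i j =
  derive_within `[t0, t1] (1 : R) (fun r => (g r).2 i j) t.
Proof.
move=> It.
rewrite -(@derive_within_section (fun z => z.2 i j) t It) //.
  exact: lform_coord.
move=> z; apply: (@continuous_comp _ _ _ snd (fun M : 'M[R]_(k.+1, n) => M i j)).
  exact: cvg_snd.
exact: coord_continuous.
Qed.

Lemma velocity_time t : t \in `[t0, t1] -> (velocity t).1 = 1.
Proof.
move=> It.
rewrite -(@derive_within_section fst t It) //; last by move=> z; exact: cvg_fst.
rewrite (@eq_derive_within _ _ _ _ _ id) //; last by move=> q; exact: sg.1.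
apply: (@derive_within_lim R R id t0 t1 _ t01) => //.
by apply: (@has_diff_lform _ R _ _ id _).2.
Qed.

End Velocity.

Lemma jext_coord (R : realType) (n k : nat) (t0 t1 : R) (s : R -> jet R n 0) t i j :
  (jext t0 t1 k s t).2 i j =
  iter i (derive_within `[t0, t1] (1 : R)) (fun r => (s r).2 ord0 j) t.
Proof. exact: mxE. Qed.

Lemma jproj_jext (R : realType) (n k : nat) (t0 t1 : R) (s : R -> jet R n 0) t :
  jproj (jext t0 t1 k.+1 s t) = jext t0 t1 k s t.
Proof.
by congr (_, _); apply/matrixP => i j; rewrite [LHS]mxE !jext_coord lift_max.
Qed.

(** For [k = 3] this links the Euler-Lagrange expression, evaluated at the fourth
    prolongation, to [dTheta] contracted with the velocity of the third. *)
Lemma velocity_jext (R : realType) (n k : nat) (t0 t1 : R) (t01 : t0 < t1)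
    (g : R -> jet R n k) (s : R -> jet R n 0) : smooth_section t0 t1 g ->
  (forall t, t \in `[t0, t1] -> g t = jext t0 t1 k s t) ->
  forall t, t \in `[t0, t1] ->
    velocity t0 t1 g t = total_vec (jext t0 t1 k.+1 s t).
Proof.
move=> sg gs t It; apply: jet_eq => [|i j]; first exact: velocity_time.
rewrite [RHS]mxE velocity_coord // jext_coord lift0 iterS.
by apply: eq_derive_within => // q Iq; rewrite gs // jext_coord.
Qed.

(** The vanishing of the contact forms on the velocity says that row [i + 1] is
    the derivative of row [i], so the rows are the iterated derivatives of row 0. *)
Lemma jext_of_contact (R : realType) (n : nat) (t0 t1 : R) (t01 : t0 < t1)
    (g : R -> jet R n 3) (s : R -> jet R n 0) : smooth_section t0 t1 g ->
  (forall t, t \in `[t0, t1] -> jproj (jproj (jproj (g t))) = s t) ->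
  (forall t, t \in `[t0, t1] -> forall i j, (i <= 2)%N ->
     contact (g t) (velocity t0 t1 g t) i j = 0) ->
  forall t, t \in `[t0, t1] -> g t = jext t0 t1 3 s t.
Proof.
move=> sg gs c0.
have E i j : (i <= 3)%N -> forall t, t \in `[t0, t1] -> (g t).2 (inord i) j =
    iter i (derive_within `[t0, t1] (1 : R)) (fun r => (s r).2 ord0 j) t.
  elim: i => [|i IH] i3 t It.
    rewrite /= -gs // !mxE; congr ((g t).2 _ j).
    by apply: ord_inj; rewrite !lift_max inordK.
  have /eqP := c0 t It i j i3.
  rewrite subr_eq0 velocity_time // mulr1 => /eqP <-.
  rewrite velocity_coord //.
  by apply: eq_derive_within => // q Iq; apply: IH => //; exact: ltnW.
move=> t It; apply: jet_eq => [|i j]; first exact: sg.1.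
by rewrite jext_coord -E // ?inord_val // -ltnS.
Qed.

(** * The Euler-Lagrange equations *)

Section EulerLagrange.
Context (R : realType) (n : nat) (t0 t1 : R) (L : jet R n 2 -> R).
Hypothesis t01 : t0 < t1.
Hypothesis sL : smooth_on (jets n 2 t0 t1) L.
Let J3 := jets n 3 t0 t1.
Let Theta := cartan_form t0 t1 L.

(** The Euler-Lagrange equations are Newton's law [d p_x / dt = L_x]. *)
Lemma euler_lagrange_expr_momentum j (z : jet R n 4) : jets n 4 t0 t1 z ->
  euler_lagrange_expr t0 t1 L j z = pd t0 t1 0 j L (jproj (jproj z))
    - derive_within J3 (total_vec z) (momentum_x t0 t1 L j) (jproj z).
Proof.
move=> Jz; have J3z : J3 (jproj z) by [].
rewrite (jets_derive_within t01 _ J3z (momentum_x_has_diff t01 sL j J3z)).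
by rewrite jproj_total_vec opprB addrA addrAC.
Qed.

Lemma contact_total_vec (z : jet R n 4) i j : (i <= 2)%N ->
  contact (jproj z) (total_vec z) i j = 0.
Proof.
move=> i2; rewrite /contact /= mulr1 !mxE lift_ord0_inord ?lift_ord_max_inord //.
  by rewrite subrr.
exact: leqW.
Qed.

(** Vertical vectors suffice: subtracting from a tangent vector the multiple of the
    velocity with the same time component changes nothing, because
    [dTheta(u, u) = 0]. *)
Lemma tangent_range_kernelP (g : R -> jet R n 3) : smooth_section t0 t1 g ->
  tangent_range t0 t1 g `<=` kernel2 J3 (ext_derive J3 Theta) <->
  (forall t, t \in `[t0, t1] -> forall w, w.1 = 0 ->
     ext_derive J3 Theta (g t) (velocity t0 t1 g t) w = 0).
Proof.
move=> sg; split=> [H t It w w1|H _ [t [c [It ->]]]].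
  have [] := H (g t, velocity t0 t1 g t); last by move=> _; exact.
  by exists t, 1; rewrite scale1r.
have Jg : J3 (g t) by rewrite /J3 /jets /= sg.1.
split=> //= w; set u := velocity t0 t1 g t.
have adm v : ProperFilter (within [set h : R | J3 (h *: v + g t)] 0^').
  exact: (@slab_proper _ _ fst t0 t1 (@lform_fst R n 3) t01).
have om_diff v := has_diff_self t01 Jg (cartan_form_has_diff t01 sL v Jg).
have lT := cartan_form_lform t0 t1 L.
rewrite -/(velocity t0 t1 g t) -/u.
rewrite (lformZ _ _ (ext_derive_lforml lT om_diff adm w)).
have -> : w = w.1 *: u + (w - w.1 *: u) by rewrite addrC subrK.
rewrite (ext_derive_lformr lT om_diff adm) ext_derivexx mulr0 add0r.
rewrite H ?mulr0 // /= velocity_time //.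
by rewrite [_ *: _]mulr1 subrr.
Qed.

Lemma euler_lagrange_kernelP (g : R -> jet R n 3) (s : R -> jet R n 0) :
  smooth_section t0 t1 g ->
  (forall t, t \in `[t0, t1] -> g t = jext t0 t1 3 s t) ->
  euler_lagrange t0 t1 L s <->
  tangent_range t0 t1 g `<=` kernel2 J3 (ext_derive J3 Theta).
Proof.
move=> sg gs; rewrite tangent_range_kernelP //.
have Eg t w : t \in `[t0, t1] -> w.1 = 0 ->
    ext_derive J3 Theta (g t) (velocity t0 t1 g t) w =
    \sum_(j < n) - euler_lagrange_expr t0 t1 L j (jext t0 t1 4 s t) * w.2 (inord 0) j.
  move=> It w1; rewrite (velocity_jext t01 sg gs It).
  have -> : g t = jproj (jext t0 t1 4 s t) by rewrite gs // jproj_jext.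
  rewrite ext_derive_cartan_holonomic //; last exact: contact_total_vec.
  apply: eq_bigr => j _; congr (_ * _).
  by rewrite euler_lagrange_expr_momentum // opprB.
split=> [EL t It w w1|H t It k].
  rewrite Eg //; apply: big1 => j _; rewrite EL // oppr0; exact: mul0r.
have := H t It (fibre_delta R 0 k) erefl; rewrite Eg //.
under eq_bigr => j _ do rewrite (@fibre_delta_coord _ _ 0 0 j k isT isT) /=.
by rewrite (sum_delta (fun j => - _)) => /eqP; rewrite oppr_eq0 => /eqP.
Qed.

End EulerLagrange.

Theorem theorem2p5 (R : realType) (n : nat) (t0 t1 : R) (ht : t0 < t1)
    (L : jet R n 2 -> R) (hL : smooth_on (jets n 2 t0 t1) L)
    (gamma : R -> jet R n 3) (hgamma : smooth_section t0 t1 gamma)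
    (sigma : R -> jet R n 0) (hsigma : smooth_section t0 t1 sigma)
    (hproj : forall t : R, t \in `[t0, t1] ->
       jproj (jproj (jproj (gamma t))) = sigma t) :
  let J3 := jets n 3 t0 t1 in
  let ker_dTheta := kernel2 J3 (ext_derive J3 (cartan_form t0 t1 L)) in
  ((forall t : R, t \in `[t0, t1] -> gamma t = jext t0 t1 3 sigma t) ->
     (euler_lagrange t0 t1 L sigma <->
      tangent_range t0 t1 gamma `<=` ker_dTheta))
  /\
  (regular t0 t1 L -> tangent_range t0 t1 gamma `<=` ker_dTheta ->
     (forall t : R, t \in `[t0, t1] -> gamma t = jext t0 t1 3 sigma t) /\
     euler_lagrange t0 t1 L sigma).
Proof.
move=> J3 ker_dTheta; split=> [gs|reg ker].
  exact: euler_lagrange_kernelP.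
have gs : forall t, t \in `[t0, t1] -> gamma t = jext t0 t1 3 sigma t.
  apply: jext_of_contact => // t It.
  have Jg : jets n 3 t0 t1 (gamma t) by rewrite /jets /= hgamma.1.
  have u1 : (velocity t0 t1 gamma t).1 = 1 by exact: velocity_time.
  apply: (regular_contact ht hL reg Jg u1).
  by move/(tangent_range_kernelP ht hL hgamma) : ker; exact.
by split=> //; apply/(euler_lagrange_kernelP ht hL hgamma gs).
Qed.
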